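(* Let $n$ be a positive integer. For every idempotent $Q\in\mathbb{C}^{n\times n}$ with matched projection $m(Q)$, we have $$\|m(Q)-Q\|_F=\sqrt{\mathrm{tr}\big(|Q^*|^2-|Q^*|\big)}.$$
   Context: An idempotent is a matrix $Q$ with $Q^2=Q$. $\|\cdot\|_F$ is the Frobenius norm, $\mathrm{tr}$ the trace, $A^*$ the conjugate transpose, $A^\dag$ the Moore-Penrose inverse, and $|A|=(A^*A)^{1/2}$ the positive semi-definite square root, so $|Q^*|=(QQ^* )^{1/2}$. For an idempotent $Q\in\mathbb{C}^{n\times n}$ the matched projection is $$m(Q)=\tfrac12\big(|Q^*|+Q^*\big)\,|Q^*|^\dag\,\big(|Q^*|+I_n\big)^{-1}\big(|Q^*|+Q\big),$$ which is known to be a projection (Hermitian idempotent). *)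

(* Defs.v *)
From mathcomp Require Import all_boot all_order all_algebra.
From mathcomp Require Import boolp classical_sets reals.
From mathcomp Require Export complex.

Set Implicit Arguments.
Unset Strict Implicit.
Unset Printing Implicit Defensive.

Import Order.TTheory GRing.Theory Num.Theory.
Local Open Scope sesquilinear_scope.
Local Open Scope ring_scope.

Section Definitions.
Variable C : numClosedFieldType.

(* On C, [0 <= z] means that z is real and nonnegative. *)
Definition psdmx n (A : 'M[C]_n) : Prop :=
  A \is hermsymmx /\ forall v : 'cV[C]_n, 0 <= (v^t* *m A *m v) 0 0.

Definition is_psd_sqrt n (A B : 'M[C]_n) : Prop := psdmx B /\ B *m B = A.

(* See [psd_sqrtP] and [psd_sqrt_unique]: for psd A this is the unique psd
   square root; it is 0 by convention when A has none. *)
Definition psd_sqrt n (A : 'M[C]_n) : 'M[C]_n :=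
  xget 0 [set B | is_psd_sqrt A B]%classic.

Definition absmx n (A : 'M[C]_n) : 'M[C]_n := psd_sqrt (A^t* *m A).

(* The four Penrose equations.  ([pinvmx] of mxalgebra is only some
   generalized inverse, not the Moore-Penrose one.) *)
Definition is_moore_penrose m n (A : 'M[C]_(m, n)) (X : 'M[C]_(n, m)) : Prop :=
  [/\ A *m X *m A = A, X *m A *m X = X,
      (A *m X)^t* = A *m X & (X *m A)^t* = X *m A].

(* See [moore_penroseP] and [moore_penrose_unique]. *)
Definition moore_penrose m n (A : 'M[C]_(m, n)) : 'M[C]_(n, m) :=
  xget 0 [set X | is_moore_penrose A X]%classic.

Definition frobenius_norm m n (A : 'M[C]_(m, n)) : C :=
  sqrtC (\sum_i \sum_j `|A i j| ^+ 2).

(* The [invmx] is a genuine inverse by [absmxD1_unit]. *)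
Definition matched_projection n (Q : 'M[C]_n) : 'M[C]_n :=
  let S := absmx (Q^t*) in
  2^-1 *: ((S + Q^t*) *m moore_penrose S *m invmx (S + 1%:M) *m (S + Q)).

End Definitions.

Section Facts.
Variable C : numClosedFieldType.

Lemma adjM m n p (A : 'M[C]_(m, n)) (B : 'M[C]_(n, p)) :
  (A *m B)^t* = B^t* *m A^t*.
Proof. by rewrite trmx_mul map_mxM. Qed.

Lemma hermsymP n (A : 'M[C]_n) : reflect (A^t* = A) (A \is hermsymmx).
Proof.
apply: (iffP (is_hermitianmxP _ _ _)); rewrite expr0 scale1r; first by move<-.
by move->.
Qed.

Lemma psdmx_row n (A : 'M[C]_n) (v : 'rV[C]_n) :
  psdmx A -> 0 <= (v *m A *m v^t*) 0 0.
Proof. by case=> _ /(_ (v^t*)); rewrite trmxCK. Qed.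

Lemma psdmx_gram m n (A : 'M[C]_(m, n)) : psdmx (A^t* *m A).
Proof.
split; first by apply/hermsymP; rewrite adjM trmxCK.
move=> v; rewrite mulmxA -adjM -mulmxA mxE sumr_ge0// => i _.
by rewrite !mxE mulrC mul_conjC_ge0.
Qed.

Lemma psdmx_sqrt_exists n (A : 'M[C]_n) : psdmx A -> exists B, is_psd_sqrt A B.
Proof.
move=> Apsd; have [Aherm _] := Apsd.
set P := spectralmx A; set d := spectral_diag A.
have PU : P \is unitarymx := spectral_unitarymx A.
have PP : P *m P^t* = 1%:M by apply/unitarymxP.
have AE : A = P^t* *m diag_mx d *m P.
  rewrite -invmx_unitary//; apply/orthomx_spectralP.
  exact: hermitian_normalmx.
have d_ge0 j : 0 <= d 0 j.
  suff <- : (row j P *m A *m (row j P)^t*) 0 0 = d 0 j by exact: psdmx_row.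
  have PAP : P *m A *m P^t* = diag_mx d.
    by rewrite AE !mulmxA PP mul1mx -mulmxA PP mulmx1.
  have := congr1 (fun M : 'M_n => M j j) PAP.
  rewrite /= [diag_mx d j j]mxE eqxx mulr1n => <-.
  by rewrite -row_mul !mxE; apply: eq_bigr => k _; rewrite !mxE.
pose s := \row_j sqrtC (d 0 j).
exists (P^t* *m diag_mx s *m P); split; last first.
  rewrite !mulmxA -[_ *m P *m _]mulmxA PP mulmx1.
  rewrite -(mulmxA (P^t*)) mulmx_diag AE; congr (_ *m diag_mx _ *m _).
  by apply/rowP=> j; rewrite !mxE -expr2 sqrtCK.
have -> : P^t* *m diag_mx s *m P = (diag_mx (\row_j sqrtC (s 0 j)) *m P)^t* *m
    (diag_mx (\row_j sqrtC (s 0 j)) *m P).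
  rewrite adjM !mulmxA -[P^t* *m _ *m diag_mx _]mulmxA.
  rewrite tr_diag_mx map_diag_mx mulmx_diag.
  congr (_ *m diag_mx _ *m _).
  apply/rowP=> j; rewrite !mxE /= geC0_conj ?sqrtC_ge0//.
  by rewrite -expr2 sqrtCK.
exact: psdmx_gram.
Qed.

Lemma psd_sqrt_unique n (A B B' : 'M[C]_n) :
  is_psd_sqrt A B -> is_psd_sqrt A B' -> B = B'.
Proof.
move=> [Bpsd BB] [B'psd BB']; apply/eqP; rewrite -subr_eq0; apply/eqP.
set D := B - B'.
have Dherm : D \is hermsymmx.
  apply/hermsymP; rewrite /D linearB/= map_mxB.
  by case: Bpsd => /hermsymP-> _; case: B'psd => /hermsymP-> _.
have BD : B *m D + D *m B' = 0.
  by rewrite /D mulmxBl mulmxBr BB BB' addrA subrK subrr.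
set P := spectralmx D; set d := spectral_diag D.
have PU : P \is unitarymx := spectral_unitarymx D.
have PP : P *m P^t* = 1%:M by apply/unitarymxP.
have DE : D = P^t* *m diag_mx d *m P.
  rewrite -invmx_unitary//; apply/orthomx_spectralP.
  exact: hermitian_normalmx.
suff d0 : d = 0.
  by rewrite DE d0 (_ : diag_mx 0 = 0) ?mulmx0 ?mul0mx ?linear0.
apply/rowP=> j; rewrite mxE; apply/eqP; apply: contraT => dj.
pose v := row j P.
have vD : v *m D = d 0 j *: v.
  rewrite /v -row_mul DE !mulmxA PP mul1mx; apply/rowP=> k.
  by rewrite mul_diag_mx !mxE.
have dreal : (d 0 j)^* = d 0 j.
  apply/CrealP; have /mxOverP := hermitian_spectral_diag_real Dherm; exact.
have Dv : D *m v^t* = d 0 j *: v^t*.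
  have /hermsymP DD := Dherm.
  by rewrite -[in LHS]DD -adjM vD linearZ/= map_mxZ/= dreal.
have v1 : v *m v^t* = 1%:M.
  apply/matrixP=> a b; rewrite !ord1 -dotmxE.
  by move/row_unitarymxP: PU => ->; rewrite eqxx mxE eqxx.
have Bv := psdmx_row v Bpsd; have B'v := psdmx_row v B'psd.
have : (v *m (B *m D + D *m B') *m v^t*) 0 0 = 0 by rewrite BD mulmx0 mul0mx mxE.
rewrite mulmxDr mulmxDl !mulmxA vD -[v *m B *m D *m _]mulmxA Dv.
rewrite -scalemxAr -!scalemxAl -scalerDr mxE => /eqP.
rewrite mulf_eq0 (negPf dj)/= mxE paddr_eq0// => /andP[/eqP b /eqP b'].
have : (v *m D *m v^t*) 0 0 = 0.
  by rewrite /D mulmxBr mulmxBl mxE b [X in _ + X]mxE b' subrr.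
by rewrite vD -scalemxAl v1 !mxE eqxx mulr1 => /eqP; rewrite (negPf dj).
Qed.

Lemma psd_sqrtP n (A : 'M[C]_n) : psdmx A -> is_psd_sqrt A (psd_sqrt A).
Proof. by move=> /psdmx_sqrt_exists[B AB]; exact: (xgetPex 0 (ex_intro _ B AB)). Qed.

Lemma absmxP n (A : 'M[C]_n) : is_psd_sqrt (A^t* *m A) (absmx A).
Proof. exact/psd_sqrtP/psdmx_gram. Qed.

Lemma absmxD1_unit n (A : 'M[C]_n) : absmx A + 1%:M \in unitmx.
Proof.
have [Spsd _] := absmxP A; rewrite -row_free_unit -kermx_eq0.
apply/rowV0P => v /sub_kermxP; rewrite mulmxDr mulmx1 => v0.
apply/eqP; apply: contraT => vN0.
have : (v *m absmx A *m v^t* + v *m v^t*) 0 0 = 0.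
  by rewrite -mulmxDl v0 mul0mx mxE.
rewrite mxE => /eqP; rewrite gt_eqF//.
by rewrite ltr_wpDl ?dotmxE ?psdmx_row -?dotmxE ?dotmx_is_dotmx.
Qed.

Lemma gram_unit m n (A : 'M[C]_(m, n)) : row_free A -> A *m A^t* \in unitmx.
Proof.
move=> Afree; rewrite -row_free_unit -kermx_eq0; apply/rowV0P => v /sub_kermxP.
move=> vAA; apply/eqP; rewrite -(mulmx_free_eq0 v Afree).
apply: contraT => vA; have := dotmx_is_dotmx vA.
by rewrite dotmxE adjM mulmxA -[v *m A *m _]mulmxA vAA mul0mx mxE ltxx.
Qed.

Lemma adj_inv n (A : 'M[C]_n) : (invmx A)^t* = invmx (A^t*).
Proof. by rewrite trmx_inv map_invmx. Qed.

Lemma moore_penrose_exists m n (A : 'M[C]_(m, n)) :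
  exists X, is_moore_penrose A X.
Proof.
have [r [F [G [AE FU GU]]]] : exists r (F : 'M_(m, r)) (G : 'M_(r, n)),
    [/\ A = F *m G, F^t* *m F \in unitmx & G *m G^t* \in unitmx].
  exists (\rank A), (col_base A), (row_base A); split.
  - by rewrite mulmx_base.
  - rewrite -[X in _ *m X]trmxCK; apply: gram_unit.
    by rewrite row_free_map /row_free mxrank_tr; exact: col_base_full.
  - exact/gram_unit/row_base_free.
pose U := invmx (G *m G^t*); pose V := invmx (F^t* *m F).
have GU1 : G *m G^t* *m U = 1%:M by rewrite mulmxV.
have VF1 : V *m (F^t* *m F) = 1%:M by rewrite mulVmx.
have Uh : U^t* = U by rewrite /U adj_inv adjM trmxCK.
have Vh : V^t* = V by rewrite /V adj_inv adjM trmxCK.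
pose X := G^t* *m U *m V *m F^t*.
have AX : A *m X = F *m V *m F^t*.
  rewrite AE /X -!mulmxA; congr (F *m _).
  by rewrite (mulmxA G) (mulmxA (G *m _)) GU1 mul1mx.
have XA : X *m A = G^t* *m U *m G.
  rewrite AE /X -!mulmxA; congr (_ *m (_ *m _)).
  by rewrite (mulmxA (F^t*)) (mulmxA V) VF1 mul1mx.
exists X; split.
- by rewrite AX AE -!mulmxA (mulmxA (F^t*)) (mulmxA V) VF1 mul1mx.
- rewrite XA /X -!mulmxA; congr (_ *m (_ *m _)).
  by rewrite (mulmxA G) (mulmxA (G *m _)) GU1 mul1mx.
- by rewrite AX !adjM trmxCK Vh mulmxA.
- by rewrite XA !adjM trmxCK Uh mulmxA.
Qed.

Lemma moore_penrose_unique m n (A : 'M[C]_(m, n)) (X Y : 'M[C]_(n, m)) :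
  is_moore_penrose A X -> is_moore_penrose A Y -> X = Y.
Proof.
move=> [AXA XAX AX XA] [AYA YAY AY YA].
have E1 : A *m X = A *m Y.
  by rewrite -[in LHS]AYA -[A *m Y *m A *m X]mulmxA -AY -AX -adjM mulmxA AXA AY.
have E2 : X *m A = Y *m A.
  by rewrite -[in LHS]AYA !mulmxA -[X *m A *m Y *m A]mulmxA -XA -YA -adjM
    -[Y *m A *m (X *m A)]mulmxA [A *m (X *m A)]mulmxA AXA YA.
by rewrite -XAX -mulmxA E1 mulmxA E2 YAY.
Qed.

Lemma moore_penroseP m n (A : 'M[C]_(m, n)) :
  is_moore_penrose A (moore_penrose A).
Proof.
by have [X AX] := moore_penrose_exists A; exact: (xgetPex 0 (ex_intro _ X AX)).
Qed.

End Facts.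

(* Main.v *)
Require Import Defs.
From mathcomp Require Import all_boot all_order all_algebra reals.

Import GRing.Theory Num.Theory.
Local Open Scope sesquilinear_scope.
Local Open Scope ring_scope.

(** Write [S = |Q^*|], so [S S = Q Q^*], and [E = S^+ (S + 1)^-1], [X = S + Q],
    so [m(Q) = X^* E X / 2].  Idempotence of [Q] gives [Q S = S], hence
    [X X^* = 2 S (S + 1)] and [X Q X^* = X Q^* X^* = S (S + 1)^2].  The first
    identity makes [m(Q)] a projection; with cyclicity of the trace, the two
    give [tr m(Q) = tr (S^+ S)] and
    [tr (m(Q) Q) = tr (Q^* m(Q)) = (tr S + tr (S^+ S)) / 2].  It remains to expand
    [tr ((m(Q) - Q)^* (m(Q) - Q))]. *)

Lemma frobenius_norm_trace {C : numClosedFieldType} {m n} (A : 'M[C]_(m, n)) :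
  frobenius_norm A = sqrtC (\tr (A^t* *m A)).
Proof.
rewrite /frobenius_norm exchange_big; congr sqrtC.
apply: eq_bigr => j _; rewrite mxE; apply: eq_bigr => i _.
by rewrite !mxE normCK mulrC.
Qed.

Lemma comm_mx_inv {F : comUnitRingType} {n} {A B : 'M[F]_n} :
  B \in unitmx -> comm_mx A B -> comm_mx A (invmx B).
Proof.
move=> Bu AB; rewrite /comm_mx -[in RHS](mulmxK Bu A) AB.
by rewrite -mulmxA mulKmx.
Qed.

(** For Hermitian [A] the Penrose equations are stable under taking adjoints of the solution, so
    uniqueness applies. *)
Lemma moore_penrose_herm {C : numClosedFieldType} {n} {A : 'M[C]_n} :
  A^t* = A -> (moore_penrose A)^t* = moore_penrose A.
Proof.
move=> Ah; have AP := moore_penroseP A; have [AXA XAX AX XA] := AP.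
apply: (moore_penrose_unique _ AP); split.
- by rewrite -[in RHS]Ah -[in RHS]AXA !adjM Ah mulmxA.
- by rewrite -[in RHS]XAX !adjM Ah mulmxA.
- by rewrite adjM trmxCK Ah -XA adjM Ah.
- by rewrite adjM trmxCK Ah -AX adjM Ah.
Qed.

(** The product of [A] and its pseudoinverse is Hermitian, and taking its adjoint swaps two
    Hermitian factors. *)
Lemma moore_penrose_comm {C : numClosedFieldType} {n} {A : 'M[C]_n} :
  A^t* = A -> comm_mx A (moore_penrose A).
Proof.
move=> Ah; have [_ _ AX _] := moore_penroseP A.
by rewrite /comm_mx -AX adjM Ah moore_penrose_herm.
Qed.

Section MatchedProjection.
Context {C : numClosedFieldType} {n : nat} {Q : 'M[C]_n}.
Hypothesis Q_idem : Q *m Q = Q.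

Let S := absmx (Q^t*).
Let E := moore_penrose S *m invmx (S + 1%:M).
Let X := S + Q.

Local Lemma absmx_herm : S^t* = S.
Proof. by have [[/hermsymP]] := absmxP (Q^t*). Qed.

Local Lemma absmx_sqr : S *m S = Q *m Q^t*.
Proof. by have [_] := absmxP (Q^t*); rewrite trmxCK. Qed.

Local Lemma idem_mul_absmx : Q *m S = S.
Proof.
have [SMS _ _ _] := moore_penroseP S.
(* Since [S^+] commutes with [S], [S = S S^+ S = S S S^+]; this exhibits a left factor [Q], which
   absorbs another [Q]. *)
have SE : S = Q *m Q^t* *m moore_penrose S.
  by rewrite -absmx_sqr -mulmxA moore_penrose_comm ?absmx_herm ?mulmxA.
by rewrite SE !mulmxA Q_idem.
Qed.

Local Lemma absmx_mul_adj : S *m Q^t* = S.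
Proof. by rewrite -[in LHS]absmx_herm -adjM idem_mul_absmx absmx_herm. Qed.

Local Lemma adjX : X^t* = S + Q^t*.
Proof. by rewrite /X linearD/= map_mxD absmx_herm. Qed.

Local Lemma adjD1 : (S + 1%:M)^t* = S + 1%:M.
Proof. by rewrite linearD/= map_mxD absmx_herm trmx1 map_mx1. Qed.

Local Lemma comm_D1 {A} : comm_mx A S -> comm_mx A (S + 1%:M).
Proof. by move=> AS; rewrite /comm_mx mulmxDr mulmxDl AS mulmx1 mul1mx. Qed.

Local Lemma comm_MP_inv : comm_mx (moore_penrose S) (invmx (S + 1%:M)).
Proof.
apply: comm_mx_inv; first exact: absmxD1_unit.
exact/comm_D1/comm_mx_sym/moore_penrose_comm/absmx_herm.
Qed.

Local Lemma adjE : E^t* = E.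
Proof.
rewrite adjM adj_inv adjD1 (moore_penrose_herm absmx_herm).
exact/esym/comm_MP_inv.
Qed.

(** Swapping [S] and [S + 1] puts [S + 1] next to its inverse in [E]. *)
Local Lemma mulE_D1 : E *m (S *m (S + 1%:M)) = moore_penrose S *m S.
Proof.
rewrite (comm_D1 (erefl : comm_mx S S)) /E -mulmxA.
by rewrite mulKmx ?absmxD1_unit.
Qed.

Local Lemma mulX_adj : X *m X^t* = 2 *: (S *m (S + 1%:M)).
Proof.
rewrite adjX /X mulmxDl !mulmxDr idem_mul_absmx absmx_mul_adj -absmx_sqr mulmx1.
by rewrite (addrC S) -mulr2n scaler_nat.
Qed.

Local Lemma matchedE : matched_projection Q = 2^-1 *: (X^t* *m E *m X).
Proof. by rewrite /matched_projection -/S adjX /E !mulmxA. Qed.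

Local Lemma mulXQ_adj :
  X *m Q *m X^t* = S *m (S + 1%:M) *m (S + 1%:M).
Proof.
(* Here [Q X^* = Q S + Q Q^* = S + S S]; the other factor [S + 1] comes from
   [X S = S S + Q S = S S + S]. *)
have -> : X *m Q *m X^t* = X *m S *m (S + 1%:M).
  by rewrite adjX -!mulmxA !mulmxDr idem_mul_absmx -absmx_sqr mulmx1 addrC.
by congr (_ *m _); rewrite /X mulmxDl idem_mul_absmx mulmxDr mulmx1.
Qed.

(** This is the adjoint of [mulXQ_adj], whose right-hand side is Hermitian, being a real polynomial
    in [S]. *)
Local Lemma mulX_adjQ_adj :
  X *m Q^t* *m X^t* = S *m (S + 1%:M) *m (S + 1%:M).
Proof.
have -> : X *m Q^t* *m X^t* = (X *m Q *m X^t*)^t*.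
  by rewrite !adjM trmxCK mulmxA.
have ST : comm_mx S (S + 1%:M) by exact: comm_D1.
by rewrite mulXQ_adj !adjM adjD1 absmx_herm -ST mulmxA -ST.
Qed.

Local Lemma adj_matched : (matched_projection Q)^t* = matched_projection Q.
Proof.
rewrite matchedE linearZ/= map_mxZ (adjM _ X) (adjM _ E) trmxCK adjE mulmxA.
by rewrite /= fmorphV rmorph_nat.
Qed.

Local Lemma matched_idem :
  matched_projection Q *m matched_projection Q = matched_projection Q.
Proof.
have [_ MSM _ _] := moore_penroseP S.
(* The Penrose equation [S^+ S S^+ = S^+] lets [S^+ S] be absorbed by [E]. The 2 from [X X^*] will
   cancel one of the two factors [2^-1]. *)
have EE : E *m (S *m (S + 1%:M)) *m E = E by rewrite mulE_D1 mulmxA MSM.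
rewrite matchedE -scalemxAl -scalemxAr; congr (_ *: _).
have -> : X^t* *m E *m X *m (X^t* *m E *m X) =
    X^t* *m (E *m (X *m X^t*) *m E) *m X.
  by rewrite !mulmxA.
rewrite mulX_adj -scalemxAr -scalemxAl EE -scalemxAr -scalemxAl.
by rewrite scalerK ?pnatr_eq0.
Qed.

Local Lemma trace_matched :
  \tr (matched_projection Q) = \tr (moore_penrose S *m S).
Proof.
rewrite matchedE mxtraceZ -mulmxA mxtrace_mulC -mulmxA mulX_adj -scalemxAr.
by rewrite mulE_D1 mxtraceZ mulKf ?pnatr_eq0.
Qed.

Local Lemma mulE_D1_sqr :
  E *m (S *m (S + 1%:M) *m (S + 1%:M)) = S + moore_penrose S *m S.
Proof.
have [SMS _ _ _] := moore_penroseP S.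
rewrite mulmxA mulE_D1 mulmxDr mulmx1; congr (_ + _).
by rewrite -(moore_penrose_comm absmx_herm).
Qed.

Local Lemma trace_matched_mul : \tr (matched_projection Q *m Q) =
  2^-1 * (\tr S + \tr (moore_penrose S *m S)).
Proof.
rewrite matchedE -scalemxAl mxtraceZ -(mulmxA _ X) -(mulmxA _ E) mxtrace_mulC.
by rewrite -(mulmxA E) mulXQ_adj mulE_D1_sqr mxtraceD.
Qed.

(** A direct computation, rather than conjugating [trace_matched_mul], avoids having to show that
    the traces on the right are real. *)
Local Lemma trace_adj_mul_matched : \tr (Q^t* *m matched_projection Q) =
  2^-1 * (\tr S + \tr (moore_penrose S *m S)).
Proof.
rewrite matchedE -scalemxAr mxtraceZ (mulmxA _ _ X) mxtrace_mulC.
rewrite (mulmxA X) (mulmxA (X *m _)).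
by rewrite mulX_adjQ_adj mxtrace_mulC mulE_D1_sqr mxtraceD.
Qed.

Lemma frobenius_norm_matched_projectionB :
  frobenius_norm (matched_projection Q - Q) = sqrtC (\tr (S *m S - S)).
Proof.
have adjB : (matched_projection Q - Q)^t* = matched_projection Q - Q^t*.
  by rewrite linearB/= map_mxB adj_matched.
rewrite frobenius_norm_trace adjB mulmxBl !mulmxBr.
rewrite !raddfB/= matched_idem trace_matched trace_matched_mul.
rewrite trace_adj_mul_matched (mxtrace_mulC (Q^t*)) -absmx_sqr.
set s := \tr S; set p := \tr (_ *m S); set t := \tr (S *m S).
(* The two cross terms are each [(s + p) / 2], so the total is [p - (s + p) + t = t - s]. *)
congr sqrtC; rewrite opprK addrA -(addrA p) -opprD.
by rewrite [2^-1 * _]mulrC -splitr opprD addrC (addrC p) subrK.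
Qed.
End MatchedProjection.

Theorem lemma3p1 (R : realType) (n : nat) (Q : 'M[R[i]]_n)
    (n_gt0 : (0 < n)%N) (Q_idem : Q *m Q = Q) :
  frobenius_norm (matched_projection Q - Q) =
  sqrtC (\tr (absmx (Q^t*) *m absmx (Q^t*) - absmx (Q^t*))).
Proof. exact: frobenius_norm_matched_projectionB. Qed.
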